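(* Let $\gamma(t)=(x(t),y(t),z(t))$ be a generic unit-speed geodesic in $\mathrm{SOL}$ with principal constants of motion $a,b$ and modulus $k$. The quantity $$H:=\sqrt{|x(t_0+T(k))-x(t_0)|\;|y(t_0+T(k))-y(t_0)|}$$ is independent of $t_0\in\mathbb{R}$. More precisely, it only depends on the modulus of the geodesic and is given by $$H=H(k)=\sqrt{|ab|}\,M(k).$$
   Context: $\mathrm{SOL}$ is $\mathbb{R}^3$ with coordinates $(x,y,z)$ and the Riemannian metric $ds^2=e^{-2z}dx^2+e^{2z}dy^2+dz^2$; it is complete and geodesics are defined on all of $\mathbb{R}$. For a unit-speed geodesic $\gamma=(x,y,z)$ the quantities $a=e^{-2z}\dot x$ and $b=e^{2z}\dot y$ are constant (the *principal constants of motion* ). The *modulus* is $k=\sqrt{\frac{1-2|ab|}{1+2|ab|}}$, so that $|ab|=\frac{1-k^2}{2(1+k^2)}$. A geodesic is *generic* if none of the coordinate functions $x(t),y(t),z(t)$ is constant; then $ab\neq0$ and $0<k<1$. With $A(k)=\operatorname{arctanh}(k)$, put $$T(k)=4\int_0^{A(k)}\frac{d\zeta}{\sqrt{1-2|ab|\cosh(2\zeta)}},\qquad M(k)=4\int_0^{A(k)}\frac{\cosh(2\zeta)\,d\zeta}{\sqrt{1-2|ab|\cosh(2\zeta)}};$$ $T(k)$ is the period of the function $z(t)$. *)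

(* Defs.v *)
From HB Require Import structures.
From mathcomp Require Import all_boot all_order all_algebra.
From mathcomp Require Import all_classical all_reals all_analysis.

Set Implicit Arguments.
Unset Strict Implicit.
Unset Printing Implicit Defensive.

Import Order.TTheory GRing.Theory Num.Theory.
Import numFieldNormedType.Exports.

Local Open Scope classical_set_scope.
Local Open Scope ring_scope.

(* A Riemannian metric on R^(n+1) in its standard global chart is represented
   by the matrix field g of its coefficients. *)

(* Christoffel symbol of the second kind, Gamma^l_(i j) at p. *)
Definition christoffel (R : realType) (n : nat)
    (g : 'rV[R]_n.+1 -> 'M[R]_n.+1) (p : 'rV[R]_n.+1) (l i j : 'I_n.+1) : R :=
  let partial (m : 'I_n.+1) (f : 'rV[R]_n.+1 -> R) := 'D_(delta_mx 0 m) f p in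
  2^-1 * \sum_m invmx (g p) l m *
    (partial i (fun q => g q j m) + partial j (fun q => g q i m)
     - partial m (fun q => g q i j)).

Definition is_geodesic (R : realType) (n : nat)
    (g : 'rV[R]_n.+1 -> 'M[R]_n.+1) (gamma : R -> 'rV[R]_n.+1) : Prop :=
  [/\ forall t : R, derivable gamma t 1,
      forall t : R, derivable (derive1 gamma) t 1 &
      forall (t : R) (l : 'I_n.+1), derive1 (derive1 gamma) t 0 l +
        \sum_i \sum_j christoffel g (gamma t) l i j *
          derive1 gamma t 0 i * derive1 gamma t 0 j = 0].

Definition unit_speed (R : realType) (n : nat)
    (g : 'rV[R]_n.+1 -> 'M[R]_n.+1) (gamma : R -> 'rV[R]_n.+1) : Prop :=
  forall t, \sum_i \sum_j
    g (gamma t) i j * derive1 gamma t 0 i * derive1 gamma t 0 j = 1.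

Definition xc {R : realType} (p : 'rV[R]_3) : R := p 0 (@Ordinal 3 0 isT).
Definition yc {R : realType} (p : 'rV[R]_3) : R := p 0 (@Ordinal 3 1 isT).
Definition zc {R : realType} (p : 'rV[R]_3) : R := p 0 (@Ordinal 3 2 isT).

Definition sol_metric {R : realType} (p : 'rV[R]_3) : 'M[R]_3 :=
  diag_mx (\row_(i < 3) [:: expR (- 2 * zc p); expR (2 * zc p); 1]`_i).

Definition principal_constants (R : realType) (gamma : R -> 'rV[R]_3)
    (a b : R) : Prop :=
  forall t, expR (- 2 * zc (gamma t)) * derive1 (xc \o gamma) t = a /\
            expR (2 * zc (gamma t)) * derive1 (yc \o gamma) t = b.

Definition generic (R : realType) (gamma : R -> 'rV[R]_3) : Prop :=
  forall i : 'I_3, ~ exists c : R, forall t, gamma t 0 i = c.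

Definition modulus (R : realType) (a b : R) : R :=
  Num.sqrt ((1 - 2 * `|a * b|) / (1 + 2 * `|a * b|)).

(* The value of |ab| for a geodesic of modulus k. *)
Definition abs_ab (R : realType) (k : R) : R :=
  (1 - k ^+ 2) / (2 * (1 + k ^+ 2)).

Definition artanh (R : realType) (k : R) : R := ln ((1 + k) / (1 - k)) / 2.

Definition cosh (R : realType) (u : R) : R := (expR u + expR (- u)) / 2.

(* The integrands below blow up at the endpoint artanh k (where the formal
   inverse makes them 0). They are nonnegative on the interval, so the improper
   integrals are the Lebesgue integrals. *)
Definition period_T (R : realType) (k : R) : R :=
  4 * \int[lebesgue_measure]_(u in `[0, artanh k])
        (Num.sqrt (1 - 2 * abs_ab k * cosh (2 * u)))^-1.

Definition integral_M (R : realType) (k : R) : R :=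
  4 * \int[lebesgue_measure]_(u in `[0, artanh k])
        (cosh (2 * u) / Num.sqrt (1 - 2 * abs_ab k * cosh (2 * u))).

Definition displacement (R : realType) (gamma : R -> 'rV[R]_3) (T t0 : R) : R :=
  Num.sqrt (`|xc (gamma (t0 + T)) - xc (gamma t0)| *
            `|yc (gamma (t0 + T)) - yc (gamma t0)|).

(* Main.v *)
Require Import Defs.
From HB Require Import structures.
From mathcomp Require Import all_boot all_order all_algebra.
From mathcomp Require Import all_classical all_reals all_analysis.
From mathcomp Require Import measurable_realfun ring lra.

Import Order.TTheory GRing.Theory Num.Theory.
Import numFieldNormedType.Exports.

Local Open Scope classical_set_scope.
Local Open Scope ring_scope.

(** Write c for |ab|, and put X = |a| e^z and Y = |b| e^(-z) along the geodesic,
    so that X Y = c. The constants of motion give x' = a e^(2z) and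
    y' = b e^(-2z), hence a x' = X^2 and b y' = Y^2; unit speed reads
    (X - Y)^2 + z'^2 = 1 - 2c; and the z-component of the geodesic equation is
    z'' = Y^2 - X^2 ([sol_geodesic_equations]). The second-order equation is
    needed besides the conservation law: the latter alone would allow z to rest
    at a turning point.

    With r = sqrt (1 - 2c), the point ((X - Y) / r, z' / r) therefore stays on
    the unit circle and moves along it with angular velocity X + Y. Lifting it to
    an angle th gives X - Y = r sin th and z' = r cos th, and since
    (X + Y)^2 = 4c + (X - Y)^2 the angle solves the autonomous equation
    th' = F(th) with F(th) = sqrt (4c + r^2 sin^2 th) > 0 ([phase_lift]). Unlike
    the energy equation for z, this equation is regular, so the whole motion is
    reduced to one-variable integrals over th: the time needed for a full turn
    is the integral of 1/F over [0, 2 pi], and X^2 and Y^2 are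
    (F^2 - 2c)/2 +- (r/2) F sin th, where the last term is the derivative of
    -+ (r/2) cos th along the motion and integrates to 0 over a full turn. Thus
    a x and b y increase by the same amount, the integral of (F^2 - 2c)/(2F)
    over [0, 2 pi] ([phase_square_increment]).

    Both integrands are even and pi-periodic in th, so a full turn is four times
    a quarter turn ([even_periodic_increment]), and the substitution
    r sin th = 2 sqrt c sinh u carries [0, pi/2] to [0, artanh k] and the two
    integrals to T(k) and c M(k) ([quarter_turn_integral]). So one full turn takes
    time T(k) ([phase_period]), from any starting time, and the product of the
    increments of x and y is (c M(k))^2 / (ab), whose absolute value is
    c M(k)^2. *)

(** * Primitives and improper integrals *)

Lemma continuous_itv_integrable {R : realType} (f : R -> R) (a b : R) :
  continuous f -> lebesgue_measure.-integrable `[a, b] (EFin \o f).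
Proof.
move=> cf; apply: continuous_compact_integrable; first exact: segment_compact.
exact: continuous_subspaceT.
Qed.

(** Integrals are available over bounded intervals with a fixed left endpoint, so
    a primitive on the whole line is glued from the primitives based at - n,
    normalised to vanish at 0; the base point depends on x through |x| + 1. *)
Lemma continuous_has_primitive {R : realType} (f : R -> R) :
  continuous f -> exists F : R -> R, forall x : R, is_derive x 1 F (f x).
Proof.
move=> cf.
pose I (a x : R) := \int[lebesgue_measure]_(t in `[a, x]) f t.
pose P (n x : R) := I (- n) x - I (- n) 0.
have shift (m n x : R) : 0 < m -> m <= n -> - m <= x -> P n x = P m x.
  move=> m0 mn mx.
  have split_at y : - m <= y -> I (- n) y = I (- n) (- m) + I (- m) y.
    move=> my; apply/eqP; rewrite addrC -subr_eq; apply/eqP.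
    have fi u v := @continuous_itv_integrable R f u v cf.
    rewrite /I (@Rintegral_itvB R f _ _ (- m)) ?bnd_simp ?lerN2//.
    rewrite Rintegral_itv_obnd_cbnd//.
    apply: integrableS (fi (- m) y) => //; exact: subset_itv_oc_cc.
  rewrite /P (split_at x)// (split_at 0) ?oppr_le0 ?ltW//.
  by rewrite opprD addrACA subrr add0r.
exists (fun x => P (`|x| + 1) x) => x.
(* Near x one has |y| + 1 <= |x| + 2, so this fixed base point serves for all y
   close to x. *)
pose n : R := `|x| + 2.
have n0 : 0 < n by rewrite /n; have := normr_ge0 x; lra.
have nx : - n < x by rewrite /n; have := ler_norm (- x); rewrite normrN; lra.
have [dP P'] : derivable (I (- n)) x 1 /\ derive1 (I (- n)) x = f x.
  apply: (@continuous_FTC1_closed R f (- n) x (x + 1)) => //; first by rewrite ltrDl.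
    exact: continuous_itv_integrable.
  exact: cf.
have dPn : is_derive x 1 (P n) (f x).
  have -> : P n = I (- n) - cst (I (- n) 0) by apply/funext.
  rewrite -(subr0 (f x)); apply: is_deriveB.
  by rewrite -P' derive1E; exact/derivableP.
have near_eq : \forall y \near x, P n y = P (`|y| + 1) y.
  near=> y.
  have : `|x - y| < 1.
    by near: y; apply: (@cvgr_dist_lt _ _ _ _ _ id) => //; exact: ltr01.
  move=> xy; apply: shift.
  - by have := normr_ge0 y; lra.
  - by rewrite /n; have := lerB_dist y x; rewrite (distrC y); lra.
  - by have := ler_norm (- y); rewrite normrN; lra.
apply: near_eq_is_derive near_eq dPn; exact: oner_neq0.
Unshelve. all: by end_near. Qed.

(** Fundamental theorem for an integrand that may blow up at the right endpoint:
    nonnegativity lets monotone convergence pass to the limit from the segments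
    [a, b - (b - a)/(n + 2)], on which f is continuous. *)
Lemma ge0_FTC2_co {R : realType} (f F : R -> R) (a b : R) : a < b ->
  (forall x : R, a <= x < b -> 0 <= f x) ->
  (forall x : R, a <= x < b -> {for x, continuous f}) ->
  {within `[a, b], continuous F} ->
  (forall x : R, a < x < b -> is_derive x 1 F (f x)) ->
  \int[lebesgue_measure]_(x in `[a, b]) f x = F b - F a.
Proof.
move=> ab f0 cf cF dF.
(* The offset n + 2 keeps every bb n strictly between a and b. *)
pose bb (n : nat) : R := b - (b - a) / n.+2%:R.
have ba0 : 0 < b - a by rewrite subr_gt0.
have bb_lt n : a < bb n < b.
  have n2 : 1 < n.+2%:R :> R by rewrite ltr1n.
  have n2' : 0 < n.+2%:R :> R by rewrite ltr0n.
  have : 0 < (b - a) / n.+2%:R by rewrite divr_gt0.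
  have : (b - a) / n.+2%:R < b - a by rewrite ltr_pdivrMr// ltr_pMr.
  by rewrite /bb; move: (_ / _) => e e1 e2; apply/andP; split; lra.
have bb_homo m n : (m <= n)%N -> bb m <= bb n.
  by move=> mn; rewrite /bb lerB// ler_pM2l// lef_pV2 ?posrE ?ltr0n// ler_nat.
have bb_cvg : bb n @[n --> \oo] --> b.
  rewrite -[X in _ --> X]subr0; apply: cvgB; first exact: cvg_cst.
  rewrite -[X in _ --> X](mulr0 (b - a)); apply: cvgMl_tmp.
  by have := @cvg_harmonic R; rewrite -cvg_shiftS.
have mf : measurable_fun `[a, b[ f.
  apply: (@subspace_continuous_measurable_fun R) => //.
  apply: continuous_in_subspaceT => x; rewrite inE/= in_itv/=.
  exact: cf.
have Uab : \bigcup_n `[a, bb n]%classic = `[a, b[%classic.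
  apply/seteqP; split => [x [n _]|x]; rewrite /= !in_itv/=.
    case/andP => -> /= /le_lt_trans; apply.
    by case/andP: (bb_lt n).
  move=> /andP[ax xb].
  have [n _ /(_ n (leqnn n))/= xn] := cvgr_gt _ bb_cvg _ xb.
  by exists n => //=; rewrite in_itv/= ax ltW.
have intn n : (\int[lebesgue_measure]_(x in `[a, bb n]) (f x)%:E =
    (F (bb n) - F a)%:E)%E.
  have /andP[abn bnb] := bb_lt n.
  have cFn : {within `[a, bb n], continuous F}.
    apply: continuous_subspaceW cF; apply: subset_itvl; rewrite bnd_simp; exact: ltW.
  have [_ cFa cFb] := (continuous_within_itvP _ abn).1 cFn.
  rewrite EFinB; apply: continuous_FTC2 => //.
  - apply: continuous_in_subspaceT => x; rewrite inE/= in_itv/= => /andP[ax xb].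
    by apply: cf; rewrite ax (le_lt_trans xb).
  - split => // x; rewrite in_itv/= => /andP[ax xb].
    have xx : a < x < b by rewrite ax (lt_trans xb).
    by case: (dF x xx).
  - move=> x; rewrite in_itv/= => /andP[ax xb].
    have xx : a < x < b by rewrite ax (lt_trans xb).
    by case: (dF x xx) => _ <-; rewrite derive1E.
rewrite /Rintegral -integral_itv_bndo_bndc; last exact/measurable_EFinP.
rewrite -Uab -[RHS]/(fine (F b - F a)%:E); congr fine.
have cvg1 : (fun n => \int[lebesgue_measure]_(x in `[a, bb n]) (f x)%:E)%E @ \oo -->
    (\int[lebesgue_measure]_(x in \bigcup_n `[a, bb n]%classic) (f x)%:E)%E.
  apply: ge0_nondecreasing_set_cvg_integral => //.
  - move=> m n mn; apply/subsetPset; apply: subset_itvl; rewrite bnd_simp; exact: bb_homo.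
  - move=> n; apply/measurable_EFinP; apply: measurable_funS mf => //.
    by apply: subset_itvl; rewrite bnd_simp; case/andP: (bb_lt n).
  - move=> n x /=; rewrite in_itv/= lee_fin => /andP[ax xb]; apply: f0.
    by rewrite ax (le_lt_trans xb)//; case/andP: (bb_lt n).
have cvg2 : (F (bb n) - F a)%:E @[n --> \oo] --> (F b - F a)%:E.
  apply: cvg_EFin; first exact: nearW.
  apply: cvgB; last exact: cvg_cst.
  have [_ _ cFb] := (continuous_within_itvP _ ab).1 cF.
  apply: ((cvg_at_leftP _ _ _).1 cFb); split => // n.
  by case/andP: (bb_lt n).
rewrite (funext intn) in cvg1.
exact: cvg_unique cvg1 cvg2.
Qed.

Lemma eq0_derive_cst {R : realType} (f : R -> R) : (forall x : R, is_derive x 1 f 0) ->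
  forall x, f x = f 0.
Proof. by move=> f0 x; apply: is_derive_0_is_cst. Qed.

Lemma is_derive_shift {R : realType} (K : R -> R) (p x d : R) :
  is_derive (x + p) 1 K d -> is_derive x 1 (fun y => K (y + p)) d.
Proof.
move=> dK; rewrite -(mulr1 d); apply: (@is_derive1_comp _ K (fun y => y + p)) => //.
apply: is_derive_eq; rewrite addr0//.
Qed.

(** The increment over two periods is four times the one over half a period: by
    periodicity K(x + p) - K(x) does not depend on x, and by evenness K is odd up
    to a constant, so that taking x = - p/2 gives K(p) - K(0) =
    2 (K(p/2) - K(0)). *)
Lemma even_periodic_increment {R : realType} (k K : R -> R) (p : R) :
  (forall x : R, is_derive x 1 K (k x)) ->
  (forall x, k (- x) = k x) -> (forall x, k (x + p) = k x) ->
  forall x, K (x + p *+ 2) - K x = 4 * (K (p / 2) - K 0).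
Proof.
move=> dK ke kp.
have shiftp x : K (x + p) - K x = K p - K 0.
  rewrite -[in RHS](add0r p).
  apply: (@eq0_derive_cst _ (fun x => K (x + p) - K x)) => y.
  rewrite -(subrr (k y)) -{1}kp.
  by apply: is_deriveB; apply: is_derive_shift.
have even x : K x + K (- x) = K 0 + K 0.
  rewrite -[X in _ = _ + K X]oppr0.
  apply: (@eq0_derive_cst _ (fun x => K x + K (- x))) => y.
  rewrite -(subrr (k y)); apply: is_deriveD.
  rewrite -{1}ke -mulrN1; apply: (@is_derive1_comp _ K -%R).
move=> x.
have := shiftp x; have := shiftp (x + p); rewrite mulr2n -addrA.
have := shiftp (- (p / 2)); have := even (p / 2).
have -> : - (p / 2) + p = p / 2 by field.
rewrite addrA; lra.
Qed.

(** * Hyperbolic functions and the arcsine *)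

Lemma expRMN {R : realType} (u : R) : expR u * expR (- u) = 1.
Proof. by rewrite expRN mulfV// gt_eqF// expR_gt0. Qed.

Definition sinh {R : realType} (u : R) : R := (expR u - expR (- u)) / 2.

Lemma sinh0 {R : realType} : sinh 0 = 0 :> R.
Proof. by rewrite /sinh oppr0 subrr mul0r. Qed.

Lemma ltr_sinh {R : realType} : {homo @sinh R : u v / u < v}.
Proof.
move=> u v uv; rewrite /sinh ltr_pM2r ?invr_gt0//.
by apply: ltrB; rewrite ltr_expR// ltrN2.
Qed.

Lemma cosh_gt0 {R : realType} (u : R) : 0 < cosh u.
Proof. by rewrite /cosh divr_gt0// addr_gt0// expR_gt0. Qed.

Lemma cosh_sqr {R : realType} (u : R) : cosh u ^+ 2 = 1 + sinh u ^+ 2.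
Proof.
rewrite /cosh /sinh; have := expRMN u.
by move: (expR u) (expR (- u)) => e f ef; field : ef.
Qed.

Lemma cosh_double {R : realType} (u : R) : cosh (2 * u) = 1 + 2 * sinh u ^+ 2.
Proof.
have dbl (v : R) : expR (2 * v) = expR v ^+ 2 by rewrite expr2 -expRD -mulr2n mulr_natl.
rewrite /cosh /sinh -mulrN !dbl; have := expRMN u.
by move: (expR u) (expR (- u)) => e f ef; field : ef.
Qed.

Lemma is_derive_sinh {R : realType} (u : R) : is_derive u 1 sinh (cosh u).
Proof.
rewrite /sinh /cosh; apply: is_derive_eq.
by rewrite !scaler0 add0r /GRing.scale/=; field.
Qed.

Lemma is_derive_continuous {R : realType} (f f' : R -> R) :
  (forall x : R, is_derive x 1 f (f' x)) -> continuous f.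
Proof.
move=> df x; apply/differentiable_continuous/derivable1_diffP.
by case: (df x).
Qed.

Lemma continuous_cosh {R : realType} : continuous (@cosh R).
Proof.
apply: (@is_derive_continuous _ _ sinh) => u; rewrite /cosh /sinh; apply: is_derive_eq.
by rewrite !scaler0 add0r /GRing.scale/=; field.
Qed.

(** Continuity up to the endpoints, where the arcsine is not differentiable; the
    quarter-turn substitution ends at asin 1. *)
Lemma continuous_asin_itv {R : realType} : {within `[-1, 1], continuous (@asin R)}.
Proof.
have := @segment_can_le_continuous R (- (pi / 2)) (pi / 2) sin asin.
rewrite sinN sin_pihalf; apply.
- by have := pi_gt0 R; lra.
- by apply: continuous_subspaceT; exact: continuous_sin.
- by move=> x xpi; rewrite sinK.
Qed.

Lemma asin0 {R : realType} : asin 0 = 0 :> R.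
Proof.
have pi0 := @pi_gt0 R; rewrite -[X in asin X]sin0 sinK//.
by rewrite in_itv/=; apply/andP; split; lra.
Qed.

Lemma asin1 {R : realType} : asin 1 = pi / 2 :> R.
Proof.
have pi0 := @pi_gt0 R; rewrite -[X in asin X]sin_pihalf sinK//.
by rewrite in_itv/=; apply/andP; split; lra.
Qed.

(** * The quarter turn as an integral over [0, A] *)

(** The angular velocity X + Y = sqrt (4XY + (X - Y)^2) of the phase, expressed
    through the angle x alone by X Y = c and X - Y = sqrt (1 - 2c) sin x. *)
Definition phase_speed {R : realType} (c x : R) : R :=
  Num.sqrt (4 * c + (1 - 2 * c) * sin x ^+ 2).

(** Substitution r sin x = 2 sqrt c sinh u with r = sqrt (1 - 2c). One has
    cos x = sqrt (1 - 2c cosh (2u)) / r and the phase speed at x is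
    2 sqrt c cosh u, whence dx / phase_speed = du / sqrt (1 - 2c cosh (2u)); the
    hypothesis on A says that u = A corresponds to x = pi/2. The factor q covers
    with one proof the period (q = 1) and the displacement
    (q(F) = (F^2 - 2c) / (2c), which becomes cosh (2u)). *)
Lemma quarter_turn_integral {R : realType} (c A : R) (q K : R -> R) :
  0 < c -> 2 * c < 1 -> 0 < A -> 2 * c * cosh (2 * A) = 1 ->
  continuous q -> (forall u : R, 0 <= q (2 * Num.sqrt c * cosh u)) ->
  (forall x : R, is_derive x 1 K (q (phase_speed c x) / phase_speed c x)) ->
  \int[lebesgue_measure]_(u in `[0, A])
    (q (2 * Num.sqrt c * cosh u) / Num.sqrt (1 - 2 * c * cosh (2 * u))) =
  K (pi / 2) - K 0.
Proof.
move=> c0 c1 A0 cA cq q0 dK.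
pose r := Num.sqrt (1 - 2 * c).
have rr : r ^+ 2 = 1 - 2 * c by rewrite sqr_sqrtr//; lra.
have r0 : 0 < r by rewrite sqrtr_gt0; lra.
pose sc := Num.sqrt c.
have scsc : sc ^+ 2 = c by rewrite sqr_sqrtr// ltW.
have sc0 : 0 < sc by rewrite sqrtr_gt0.
pose s (u : R) := 2 * sc / r * sinh u.
have ss u : r ^+ 2 * (1 - s u ^+ 2) = 1 - 2 * c * cosh (2 * u).
  rewrite /s cosh_double rr.
  have -> : (2 * sc / r * sinh u) ^+ 2 = 4 * c / (1 - 2 * c) * sinh u ^+ 2.
    by rewrite -rr -scsc; field; rewrite gt_eqF.
  by field; rewrite gt_eqF//; lra.
have s_incr (u v : R) : u < v -> s u < s v.
  by move=> uv; rewrite /s ltr_pM2l ?ltr_sinh// divr_gt0// mulr_gt0.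
have s0 : s 0 = 0 by rewrite /s sinh0 mulr0.
have sA0 : 0 < s A by rewrite -s0 s_incr.
have sA : s A = 1.
  have : r ^+ 2 * (1 - s A ^+ 2) = 0 by rewrite ss cA subrr.
  move/eqP; rewrite mulf_eq0 expf_eq0/= (gt_eqF r0)/= subr_eq0 eq_sym.
  by rewrite -[X in _ == X](expr1n _ 2) eqrXn2// ?ltW// => /eqP.
have ds (u : R) : is_derive u 1 s (2 * sc / r * cosh u).
  exact: (is_deriveZ _ (is_derive_sinh u)).
have cs : continuous s by apply: is_derive_continuous ds.
have s_bnd (u : R) : 0 <= u < A -> 0 <= s u < 1.
  rewrite -sA -{2}s0 le_eqVlt => /andP[/predU1P[<-|u0] uA].
    by rewrite lexx s_incr.
  by rewrite !s_incr// andbT ltW// s_incr.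
have rad_gt0 u : 0 <= u < A -> 0 < 1 - s u ^+ 2.
  by move/s_bnd => /andP[? ?]; rewrite subr_gt0 expr_lt1.
have sqrtE u : Num.sqrt (1 - 2 * c * cosh (2 * u)) = r * Num.sqrt (1 - s u ^+ 2).
  by rewrite -ss sqrtrM ?sqr_ge0// sqrtr_sqr gtr0_norm.
have speedE u : 0 <= u < A -> phase_speed c (asin (s u)) = 2 * sc * cosh u.
  move=> /s_bnd/andP[u0 u1].
  rewrite /phase_speed asinK; last by rewrite in_itv/= (ltW u1) andbT (le_trans _ u0)// lerN10.
  have -> : 4 * c + (1 - 2 * c) * s u ^+ 2 = (2 * sc * cosh u) ^+ 2.
    by rewrite [RHS]exprMn cosh_sqr /s -rr -scsc; field; rewrite gt_eqF.
  by rewrite sqrtr_sqr ger0_norm// mulr_ge0 ?ltW ?cosh_gt0// mulr_gt0.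
have -> : K (pi / 2) - K 0 = (K \o asin \o s) A - (K \o asin \o s) 0.
  by rewrite /= s0 sA asin0 asin1.
have crad : continuous (fun u : R => 1 - 2 * c * cosh (2 * u)).
  move=> u; apply: cvgB; first exact: cvg_cst.
  have c2 := @mulrl_continuous R 2 u.
  by apply: cvgMl_tmp; exact: (continuous_comp c2 (continuous_cosh _)).
have dKs (u : R) : 0 <= u < A -> is_derive u 1 (K \o asin \o s)
    (q (2 * sc * cosh u) / Num.sqrt (1 - 2 * c * cosh (2 * u))).
  move=> uA; have /andP[su0 su1] := s_bnd _ uA.
  have su : -1 < s u < 1 by rewrite su1 andbT (lt_le_trans _ su0)// ltrN10.
  have dasin := @is_derive1_asin R (s u) su.
  have := @is_derive1_comp R K (asin \o s) u _ _ (dK _)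
     (@is_derive1_comp R asin s u _ _ dasin (ds u)).
  move=> dd; apply: is_derive_eq dd _.
  rewrite /= speedE// sqrtE; field.
  by rewrite !gt_eqF// ?cosh_gt0// sqrtr_gt0 rad_gt0.
apply: ge0_FTC2_co => //.
- by move=> u _; rewrite divr_ge0// sqrtr_ge0.
- move=> u uA.
  apply: (@continuousM _ _ (fun u => q (2 * sc * cosh u))
    (fun u => (Num.sqrt (1 - 2 * c * cosh (2 * u)))^-1)).
    apply: continuous_comp; last exact: cq.
    by apply: cvgMl_tmp; exact: continuous_cosh.
  apply: cvgV; first by rewrite sqrtE gt_eqF// mulr_gt0// sqrtr_gt0 rad_gt0.
  exact: (continuous_comp (crad u) (@sqrt_continuous R _)).
- apply/(continuous_within_itvP _ A0).
  have cdiff (u : R) : 0 <= u < A -> {for u, continuous (K \o asin \o s)}.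
    move=> /dKs[dKs_u _].
    exact/differentiable_continuous/derivable1_diffP.
  split.
  + by move=> u; rewrite in_itv/= => /andP[/ltW u0 uA]; apply: cdiff; rewrite u0.
  + by apply: cvg_at_right_filter; apply: cdiff; rewrite lexx.
  (* At u = A the arcsine reaches the end of its domain, so only one-sided
     continuity is left. *)
  + have cK : continuous K by apply: is_derive_continuous dK.
    have N11 : -1 < 1 :> R by lra.
    have [_ _ asin_left] := (continuous_within_itvP asin N11).1 continuous_asin_itv.
    have s_left : s x @[x --> A^'-] --> s A by apply: cvg_at_left_filter; exact: cs.
    have := @increasing_cvg_at_left_comp R s asin (BLeft 0) A (asin 1).
    rewrite bnd_simp sA => /(_ A0) asin_comp.
    have {asin_comp} as_left : (asin \o s) x @[x --> A^'-] --> asin 1.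
      by apply: asin_comp => //; [move=> u v _ _; exact: s_incr | rewrite -sA].
    rewrite /= sA; exact: (continuous_cvg _ (cK _) as_left).
- by move=> u /andP[/ltW u0 uA]; apply: dKs; rewrite u0.
Qed.

(** * The phase of the vertical motion *)

Lemma polar_angle {R : realType} (u v : R) : u ^+ 2 + v ^+ 2 = 1 ->
  exists x : R, sin x = u /\ cos x = v.
Proof.
move=> uv.
have u1 : -1 <= u <= 1.
  by rewrite -ler_norml -(@expr_le1 _ 2)// real_normK ?num_real//; have := sqr_ge0 v; lra.
have cosE : cos (asin u) = `|v|.
  by rewrite cos_asin// -sqrtr_sqr; congr Num.sqrt; lra.
(* The arcsine only reaches the half circle v >= 0; the other half is its
   reflection x |-> pi - x. *)
have [v0|v0] := leP 0 v.
  by exists (asin u); rewrite asinK// cosE ger0_norm.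
exists (pi - asin u); rewrite sinB cosB sinpi cospi asinK// cosE ltr0_norm//.
by split; ring.
Qed.

Lemma phase_speed_gt0 {R : realType} (c x : R) : 0 < c -> 2 * c < 1 ->
  0 < phase_speed c x.
Proof.
by move=> c0 c1; rewrite sqrtr_gt0; have := sqr_ge0 (sin x); nra.
Qed.

Lemma phase_speed_sqr {R : realType} (c x : R) : 0 < c -> 2 * c < 1 ->
  phase_speed c x ^+ 2 = 4 * c + (1 - 2 * c) * sin x ^+ 2.
Proof.
by move=> c0 c1; rewrite sqr_sqrtr//; have := sqr_ge0 (sin x); nra.
Qed.

Lemma continuous_phase_speed {R : realType} (c : R) : continuous (phase_speed c).
Proof.
move=> x.
have crad : {for x, continuous (fun x : R => 4 * c + (1 - 2 * c) * sin x ^+ 2)}.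
  apply: cvgD; first exact: cvg_cst.
  by apply: cvgMl_tmp; apply: cvgM; exact: continuous_sin.
exact: (continuous_comp crad (@sqrt_continuous R _)).
Qed.

(** The vector ((X - Y)/r, v/r) is a unit vector whose derivative is X + Y times
    its quarter-turn rotation. The lift th is the primitive of X + Y with the
    right initial angle: the scalar product of that vector with
    (sin th, cos th) is then constant, equal to 1, and two unit vectors with
    scalar product 1 coincide. *)
Lemma phase_lift {R : realType} (c : R) (X Y v : R -> R) :
  0 < c -> 2 * c < 1 ->
  (forall t : R, is_derive t 1 X (X t * v t)) ->
  (forall t : R, is_derive t 1 Y (- (Y t * v t))) ->
  (forall t : R, is_derive t 1 v (Y t ^+ 2 - X t ^+ 2)) ->
  (forall t, X t * Y t = c) -> (forall t, 0 < X t + Y t) ->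
  (forall t, (X t - Y t) ^+ 2 + v t ^+ 2 = 1 - 2 * c) ->
  exists th : R -> R,
  [/\ forall t : R, is_derive t 1 th (phase_speed c (th t)),
      forall t, X t + Y t = phase_speed c (th t) &
      forall t, X t - Y t = Num.sqrt (1 - 2 * c) * sin (th t)].
Proof.
move=> c0 c1 dX dY dv XY XY0 E.
set r := Num.sqrt (1 - 2 * c).
have rr : r ^+ 2 = 1 - 2 * c by rewrite sqr_sqrtr//; lra.
have r0 : 0 < r by rewrite sqrtr_gt0; lra.
have rn0 : r != 0 by rewrite gt_eqF.
pose p t := (X t - Y t) / r; pose q t := v t / r.
have pq1 t : p t ^+ 2 + q t ^+ 2 = 1.
  by rewrite /p /q !expr_div_n -mulrDl E -rr divff// expf_neq0.
have [x0 [sx0 cx0]] := polar_angle (p 0) (q 0) (pq1 0).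
have cX : continuous X by apply: is_derive_continuous dX.
have cY : continuous Y by apply: is_derive_continuous dY.
have [Phi dPhi] : exists F : R -> R, forall t : R, is_derive t 1 F (X t + Y t).
  by apply: continuous_has_primitive => t; apply: cvgD; [exact: cX|exact: cY].
pose th t := x0 + (Phi t - Phi 0).
have th0 : th 0 = x0 by rewrite /th subrr addr0.
have dth (t : R) : is_derive t 1 th (X t + Y t).
  by rewrite /th; apply: is_derive_eq; ring.
have dp (t : R) : is_derive t 1 p (q t * (X t + Y t)).
  rewrite /p /q; apply: is_derive_eq; rewrite !scaler0 /GRing.scale/=.
  by field.
have dq (t : R) : is_derive t 1 q (- (p t * (X t + Y t))).
  rewrite /p /q; apply: is_derive_eq; rewrite !scaler0 /GRing.scale/=.
  by field.
have inner1 t : p t * sin (th t) + q t * cos (th t) = 1.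
  have -> : 1 = p 0 * sin (th 0) + q 0 * cos (th 0).
    by rewrite th0 sx0 cx0 -!expr2 pq1.
  apply: (eq0_derive_cst (fun t => p t * sin (th t) + q t * cos (th t))) => s.
  have dsin := @is_derive1_comp R sin th s _ _ (is_derive_sin _) (dth s).
  have dcos := @is_derive1_comp R cos th s _ _ (is_derive_cos _) (dth s).
  have dd := is_deriveD (is_deriveM (dp s) dsin) (is_deriveM (dq s) dcos).
  by apply: is_derive_eq dd _; rewrite /GRing.scale/=; ring.
have pqE t : p t = sin (th t) /\ q t = cos (th t).
  have h : (p t - sin (th t)) ^+ 2 + (q t - cos (th t)) ^+ 2 = 0.
    by have := inner1 t; have := pq1 t; have := cos2Dsin2 (th t); lra.
  move/eqP: h; rewrite paddr_eq0 ?sqr_ge0// !expf_eq0/= !subr_eq0.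
  by case/andP => /eqP -> /eqP ->.
have diffE t : X t - Y t = r * sin (th t).
  by rewrite -(pqE t).1 /p mulrC divfK.
have sumE t : X t + Y t = phase_speed c (th t).
  rewrite /phase_speed -rr -exprMn -diffE.
  have -> : 4 * c + (X t - Y t) ^+ 2 = (X t + Y t) ^+ 2 by rewrite -(XY t); ring.
  by rewrite sqrtr_sqr gtr0_norm.
by exists th; split => // t; rewrite -sumE.
Qed.

(** The integrand depends on x through sin^2 x only, hence is even and
    pi-periodic. *)
Lemma phase_increment {R : realType} (c A : R) (q : R -> R) :
  0 < c -> 2 * c < 1 -> 0 < A -> 2 * c * cosh (2 * A) = 1 ->
  continuous q -> (forall u : R, 0 <= q (2 * Num.sqrt c * cosh u)) ->
  exists2 K : R -> R,
    (forall x : R, is_derive x 1 K (q (phase_speed c x) / phase_speed c x)) &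
    forall x, K (x + pi *+ 2) - K x = 4 * \int[lebesgue_measure]_(u in `[0, A])
      (q (2 * Num.sqrt c * cosh u) / Num.sqrt (1 - 2 * c * cosh (2 * u))).
Proof.
move=> c0 c1 A0 cA cq q0.
have [K dK] : exists K : R -> R,
    forall x : R, is_derive x 1 K (q (phase_speed c x) / phase_speed c x).
  apply: continuous_has_primitive => x; apply: cvgM.
    exact: (continuous_comp (continuous_phase_speed c x) (cq _)).
  by apply: cvgV; [rewrite gt_eqF// phase_speed_gt0|exact: continuous_phase_speed].
exists K => // x; rewrite (quarter_turn_integral c A q K)//.
apply: (even_periodic_increment _ K pi dK) => y.
- by rewrite /phase_speed sinN sqrrN.
- by rewrite /phase_speed sinDpi sqrrN.
Qed.

(** A primitive G of 1/phase_speed measures time along the motion, that is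
    G(th t) - t is constant. A full turn thus costs the same time from every
    angle, and G is injective because it is strictly increasing. *)
Lemma phase_period {R : realType} (c A : R) (th : R -> R) :
  0 < c -> 2 * c < 1 -> 0 < A -> 2 * c * cosh (2 * A) = 1 ->
  (forall t : R, is_derive t 1 th (phase_speed c (th t))) ->
  forall t, th (t + 4 * \int[lebesgue_measure]_(u in `[0, A])
      (Num.sqrt (1 - 2 * c * cosh (2 * u)))^-1) = th t + pi *+ 2.
Proof.
move=> c0 c1 A0 cA dth t.
have [G dG GE] := phase_increment c A (cst 1) c0 c1 A0 cA
  (@cst_continuous R R 1) (fun=> ler01).
set T := 4 * _.
have {}GE x : G (x + pi *+ 2) - G x = T.
  by rewrite GE /T; congr (4 * _); apply: eq_Rintegral => u _; rewrite /= mul1r.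
have {}dG (x : R) : is_derive x 1 G (phase_speed c x)^-1.
  by have := dG x; rewrite mul1r.
have Gth s : G (th s) = s + G (th 0).
  apply/eqP; rewrite addrC -subr_eq; apply/eqP.
  have -> : G (th 0) = G (th 0) - 0 by rewrite subr0.
  apply: (eq0_derive_cst (fun s => G (th s) - s)) => y.
  have dGth := @is_derive1_comp R G th y _ _ (dG (th y)) (dth y).
  apply: is_derive_eq (is_deriveB dGth (is_derive_id y 1)) _.
  by rewrite mulVf ?subrr// gt_eqF// phase_speed_gt0.
have Gincr x y : x < y -> G x < G y.
  move=> xy; apply: (@gtr0_derive1_lt_cc R G x y).
  - by move=> z _; case: (dG z).
  - by move=> z _; rewrite derive1E; case: (dG z) => _ ->; rewrite invr_gt0 phase_speed_gt0.
  - by apply: continuous_subspaceT; apply: is_derive_continuous dG.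
  - by rewrite in_itv/= lexx (ltW xy).
  - by rewrite in_itv/= lexx (ltW xy).
  - exact: xy.
have Geq : G (th (t + T)) = G (th t + pi *+ 2).
  by have := GE (th t); have := Gth t; have := Gth (t + T); lra.
by have [/Gincr|/Gincr|//] := ltgtP (th (t + T)) (th t + pi *+ 2); rewrite Geq ltxx.
Qed.

(** With F the phase speed and r = sqrt (1 - 2c), the square that is the derivative
    of f expands into an even part (F^2 - 2c)/2 and an odd part (e r / 2) F sin th. The latter is minus the derivative of
    (e r / 2) cos th, so it contributes nothing over a full turn: this is why the
    two signs e = 1 and e = -1, that is x and y, give the same increment. *)
Lemma phase_square_increment {R : realType} (c A e : R) (th f : R -> R) :
  0 < c -> 2 * c < 1 -> 0 < A -> 2 * c * cosh (2 * A) = 1 -> e ^+ 2 = 1 ->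
  (forall t : R, is_derive t 1 th (phase_speed c (th t))) ->
  (forall t : R, is_derive t 1 f
     (((phase_speed c (th t) + e * (Num.sqrt (1 - 2 * c) * sin (th t))) / 2) ^+ 2)) ->
  forall t s, th s = th t + pi *+ 2 ->
  f s - f t = c * (4 * \int[lebesgue_measure]_(u in `[0, A])
      (cosh (2 * u) / Num.sqrt (1 - 2 * c * cosh (2 * u)))).
Proof.
move=> c0 c1 A0 cA e1 dth df t s th_s.
set r := Num.sqrt (1 - 2 * c) in df.
have rr : r ^+ 2 = 1 - 2 * c by rewrite sqr_sqrtr//; lra.
have cn0 : c != 0 by rewrite gt_eqF.
pose q (x : R) := (x ^+ 2 - 2 * c) / (2 * c).
have cq : continuous q.
  apply: (@is_derive_continuous _ _ (fun x => x / c)) => x; rewrite /q; apply: is_derive_eq.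
  by rewrite !scaler0 /GRing.scale/=; field.
have qE u : q (2 * Num.sqrt c * cosh u) = cosh (2 * u).
  have sqrE : (2 * Num.sqrt c * cosh u) ^+ 2 = 4 * c * (1 + sinh u ^+ 2).
    by rewrite -cosh_sqr -[in RHS](sqr_sqrtr (ltW c0)); ring.
  by rewrite /q sqrE cosh_double; field.
have q0 u : 0 <= q (2 * Num.sqrt c * cosh u).
  by rewrite qE ltW// cosh_gt0.
have [J dJ JE] := phase_increment c A q c0 c1 A0 cA cq q0.
have fE y : f y - (c * J (th y) - e * r / 2 * cos (th y)) =
            f 0 - (c * J (th 0) - e * r / 2 * cos (th 0)).
  apply: (eq0_derive_cst (fun y => f y - (c * J (th y) - e * r / 2 * cos (th y)))) => z.
  have dJth := @is_derive1_comp R J th z _ _ (dJ (th z)) (dth z).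
  have dcos := @is_derive1_comp R cos th z _ _ (is_derive_cos (th z)) (dth z).
  have dd := is_deriveB (df z)
    (is_deriveB (is_deriveZ c dJth) (is_deriveZ (e * r / 2) dcos)).
  apply: is_derive_eq dd _.
  have F0 : phase_speed c (th z) != 0 by rewrite gt_eqF// phase_speed_gt0.
  have := phase_speed_sqr c (th z) c0 c1.
  rewrite divfK// /q /GRing.scale/= -rr.
  move: (phase_speed _ _) (sin _) => F S FF.
  have -> : ((F + e * (r * S)) / 2) ^+ 2 =
    (F ^+ 2 + e ^+ 2 * (r ^+ 2 * S ^+ 2) + 2 * e * r * S * F) / 4 by field.
  by rewrite e1 mul1r FF; field.
have -> : f s - f t = c * (J (th t + pi *+ 2) - J (th t)).
  by have := fE s; have := fE t; rewrite th_s cosD2pi; lra.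
rewrite JE; congr (c * (4 * _)).
by apply: eq_Rintegral => u _; rewrite qE.
Qed.

(** * Geodesics of SOL *)

Local Notation ix := (@Ordinal 3 0 isT).
Local Notation iy := (@Ordinal 3 1 isT).
Local Notation iz := (@Ordinal 3 2 isT).

Lemma sum_I3 {R : realType} (F : 'I_3 -> R) : \sum_i F i = F ix + F iy + F iz.
Proof.
rewrite !big_ord_recl big_ord0 addr0 addrA.
by congr (F _ + F _ + F _); apply/val_inj.
Qed.

Lemma diagonal_form {R : realType} (G : 'I_3 -> 'I_3 -> R) (w : seq R) (u : 'I_3 -> R)
    (x y z : R) :
  (forall i j, G i j = w`_i *+ (i == j)) ->
  u ix = x -> u iy = y -> u iz = z ->
  \sum_i \sum_j G i j * u i * u j =
  w`_0 * x ^+ 2 + w`_1 * y ^+ 2 + w`_2 * z ^+ 2.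
Proof.
by move=> GE <- <- <-; rewrite sum_I3 !sum_I3 !GE /=; ring.
Qed.

Lemma I3P (P : 'I_3 -> Prop) : P ix -> P iy -> P iz -> forall i, P i.
Proof.
move=> P0 P1 P2 [[|[|[|//]]] ilt].
- by rewrite (_ : Ordinal ilt = ix)//; exact/val_inj.
- by rewrite (_ : Ordinal ilt = iy)//; exact/val_inj.
- by rewrite (_ : Ordinal ilt = iz)//; exact/val_inj.
Qed.

(** Reduces a partial derivative to a derivative in one real variable. *)
Lemma derive_along_line {R : realType} (n : nat) (f : 'rV[R]_n.+1 -> R)
    (p v : 'rV[R]_n.+1) :
  'D_v f p = 'D_1 (fun h : R => f (h *: v + p)) 0.
Proof.
pose g (h : R) := f (h *: v + p).
rewrite /derive -/g.
suff -> : (fun h : R => h^-1 *: ((f \o shift p) (h *: v) - f p)) =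
          (fun h : R => h^-1 *: ((g \o shift 0) (h *: 1) - g 0)) by [].
by apply/funext => h; rewrite /g /= scale0r add0r addr0 /GRing.scale/= mulr1.
Qed.

Lemma partial_exp_zc {R : realType} (m : R) (p v : 'rV[R]_3) :
  'D_v (fun q => expR (m * zc q)) p = m * zc v * expR (m * zc p).
Proof.
rewrite derive_along_line.
have -> : (fun h : R => expR (m * zc (h *: v + p))) =
          (fun h : R => expR (h * (m * zc v) + m * zc p)).
  by apply/funext => h; congr expR; rewrite /zc !mxE; ring.
have dd : is_derive (0 : R) (1 : R)
    (fun h : R => expR (h * (m * zc v) + m * zc p)) (m * zc v * expR (m * zc p)).
  apply: is_derive_eq; rewrite /GRing.scale/= mul0r add0r; ring.
by case: dd.
Qed.

Lemma sol_metricE {R : realType} (q : 'rV[R]_3) (i j : 'I_3) : sol_metric q i j =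
  [:: expR (- 2 * zc q); expR (2 * zc q); 1]`_i *+ (i == j).
Proof. by rewrite /sol_metric !mxE. Qed.

(** The row of the inverse metric that enters the Christoffel symbols with upper
    index z; it makes their sum over m collapse to m = z. *)
Lemma invmx_sol_metric {R : realType} (p : 'rV[R]_3) (j : 'I_3) :
  invmx (sol_metric p) iz j = (iz == j)%:R.
Proof.
pose d : 'rV[R]_3 := \row_(i < 3) ([:: expR (- 2 * zc p); expR (2 * zc p); 1]`_i)^-1.
have gd : sol_metric p *m diag_mx d = 1%:M.
  apply/matrixP => i k; rewrite mul_mx_diag !mxE.
  have [<-{k}|_] := eqVneq i k; last by rewrite !mulr0n mul0r.
  by rewrite !mulr1n; elim/I3P: i => /=; rewrite divff ?oner_neq0 ?gt_eqF ?expR_gt0.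
have [gu _] := mulmx1_unit gd.
by rewrite -[invmx _]mulmx1 -gd mulKmx// !mxE /= invr1.
Qed.

Lemma partial_sol_metric {R : realType} (p : 'rV[R]_3) (m i j : 'I_3) :
  'D_(delta_mx 0 m) (fun q => sol_metric q i j) p =
  (m == iz)%:R * ([:: - 2 * expR (- 2 * zc p); 2 * expR (2 * zc p); 0]`_i *+ (i == j)).
Proof.
have zcm : zc (delta_mx 0 m : 'rV[R]_3) = (m == iz)%:R.
  by rewrite /zc mxE eqxx/= eq_sym.
have d0 (c : R) : 'D_(delta_mx 0 m) (fun=> c) p = 0 by exact: derive_cst.
under eq_fun do rewrite sol_metricE.
have [_|_] := eqVneq i j; last by rewrite mulr0n mulr0 d0.
under eq_fun do rewrite mulr1n.
elim/I3P: i => /=; rewrite ?partial_exp_zc ?zcm ?d0 mulr1n ?mulr0//; ring.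
Qed.

(** The symbol is - (1/2) times the z-derivative of g_ij, because the other two
    partial derivatives are those of the constant coefficients g_iz and g_jz. *)
Lemma sol_christoffel_z {R : realType} (p : 'rV[R]_3) (i j : 'I_3) :
  christoffel sol_metric p iz i j =
  [:: expR (- 2 * zc p); - expR (2 * zc p); 0]`_i *+ (i == j).
Proof.
have sum_row (w F : 'I_3 -> R) : (forall j, w j = (iz == j)%:R) ->
    \sum_m w m * F m = F iz.
  by move=> wE; rewrite sum_I3 !wE /=; ring.
rewrite /christoffel (sum_row _ _ (invmx_sol_metric p)).
rewrite !partial_sol_metric.
by elim/I3P: i; elim/I3P: j; rewrite /= ?mulr0n ?mulr1n; field.
Qed.

Lemma derive1_coord {R : realType} (gamma : R -> 'rV[R]_3) (t : R) (i : 'I_3) :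
  derivable gamma t 1 ->
  is_derive t 1 (fun s => gamma s 0 i) (derive1 gamma t 0 i).
Proof.
move=> dg; rewrite derive1E derive_mx// mxE; apply/derivableP.
exact: ((derivable_mxP _ _ _).1 dg).
Qed.

(** The constants of motion solve the x and y components for x' and y';
    substituting them in the z component and in the unit-speed condition leaves a
    closed system for z, where v stands for z'. *)
Lemma sol_geodesic_equations {R : realType} (gamma : R -> 'rV[R]_3) (a b : R) :
  is_geodesic sol_metric gamma -> unit_speed sol_metric gamma ->
  principal_constants gamma a b ->
  exists v : R -> R,
  [/\ forall t : R, is_derive t 1 (xc \o gamma) (a * expR (2 * zc (gamma t))),
      forall t : R, is_derive t 1 (yc \o gamma) (b * expR (- 2 * zc (gamma t))),
      forall t : R, is_derive t 1 (zc \o gamma) (v t),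
      forall t : R, is_derive t 1 v
        (b ^+ 2 * expR (- 2 * zc (gamma t)) - a ^+ 2 * expR (2 * zc (gamma t))) &
      forall t, a ^+ 2 * expR (2 * zc (gamma t)) +
        b ^+ 2 * expR (- 2 * zc (gamma t)) + v t ^+ 2 = 1].
Proof.
move=> [dg ddg geo] unit ab.
have dxyz t i := derive1_coord gamma t i (dg t).
have expE t : expR (2 * zc (gamma t)) * expR (- 2 * zc (gamma t)) = 1.
  by rewrite mulNr expRMN.
have dxE t : derive1 gamma t 0 ix = a * expR (2 * zc (gamma t)).
  have [<- _] := ab t.
  have -> : derive1 (xc \o gamma) t = derive1 gamma t 0 ix.
    by rewrite derive1E; case: (dxyz t ix).
  by rewrite mulrAC [_ * expR (2 * _)]mulrC expE mul1r.
have dyE t : derive1 gamma t 0 iy = b * expR (- 2 * zc (gamma t)).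
  have [_ <-] := ab t.
  have -> : derive1 (yc \o gamma) t = derive1 gamma t 0 iy.
    by rewrite derive1E; case: (dxyz t iy).
  by rewrite mulrAC expE mul1r.
exists (fun t => derive1 gamma t 0 iz); split => t.
- by rewrite -dxE; exact: dxyz.
- by rewrite -dyE; exact: dxyz.
- exact: dxyz.
- have := geo t iz.
  rewrite (diagonal_form _ _ (fun i => derive1 gamma t 0 i) _ _ _
    (sol_christoffel_z (gamma t)) (dxE t) (dyE t) erefl) /= => geo_t.
  have := derive1_coord (derive1 gamma) t iz (ddg t).
  suff -> : derive1 (derive1 gamma) t 0 iz = b ^+ 2 * expR (- 2 * zc (gamma t)) -
      a ^+ 2 * expR (2 * zc (gamma t)) by [].
  apply/eqP; rewrite -subr_eq0 -geo_t; apply/eqP; ring : (expE t).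
- have := unit t.
  rewrite (diagonal_form _ _ (fun i => derive1 gamma t 0 i) _ _ _
    (sol_metricE (gamma t)) (dxE t) (dyE t) erefl) /= => unit_t.
  rewrite -[RHS]unit_t; ring : (expE t).
Qed.

(** * The modulus and the displacement over a period *)

(** The modulus is chosen so that A = artanh k is the maximal elongation of the
    vertical motion: exp (2A) = (1 + k)/(1 - k), whence
    cosh (2A) = (1 + k^2)/(1 - k^2) = 1/(2 |ab|). *)
Lemma modulus_spec {R : realType} (a b : R) :
  0 < `|a * b| -> 2 * `|a * b| < 1 ->
  [/\ abs_ab (modulus a b) = `|a * b|, 0 < artanh (modulus a b) &
      2 * `|a * b| * cosh (2 * artanh (modulus a b)) = 1].
Proof.
rewrite /modulus; move: `|a * b| => c c0 c1.
set k := Num.sqrt _.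
have kk : k ^+ 2 = (1 - 2 * c) / (1 + 2 * c).
  by rewrite sqr_sqrtr// divr_ge0//; lra.
have k0 : 0 < k by rewrite sqrtr_gt0 divr_gt0//; lra.
have k1 : k < 1.
  rewrite -(@expr_lt1 _ 2) ?ltW// kk ltr_pdivrMr; lra.
have kn : 1 - k != 0 by rewrite gt_eqF//; lra.
have kp : 1 + k != 0 by rewrite gt_eqF//; lra.
have cn : 1 + 2 * c != 0 by rewrite gt_eqF//; lra.
have cE : (1 - k ^+ 2) / (2 * (1 + k ^+ 2)) = c.
  by rewrite kk; field; rewrite cn/= gt_eqF//; lra.
have quot1 : 1 < (1 + k) / (1 - k) by rewrite ltr_pdivlMr; lra.
split => //.
- by rewrite /artanh divr_gt0// ln_gt0.
- have -> : 2 * artanh k = ln ((1 + k) / (1 - k)) by rewrite /artanh; field.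
  rewrite /cosh expRN lnK; last by rewrite posrE; lra.
  rewrite -{1}cE; field; rewrite kn kp gt_eqF//.
  by have := sqr_ge0 k; lra.
Qed.

Theorem corollary4p12 (R : realType) :
  exists H : R -> R,
    forall (gamma : R -> 'rV[R]_3) (a b : R),
      is_geodesic sol_metric gamma ->
      unit_speed sol_metric gamma ->
      generic gamma ->
      principal_constants gamma a b ->
      let k := modulus a b in
      (forall t0 : R, displacement gamma (period_T k) t0 = H k) /\
      H k = Num.sqrt `|a * b| * integral_M k.
Proof.
exists (fun k => Num.sqrt (abs_ab k) * integral_M k) => gamma a b geo unit gen ab k.
have [v [dx dy dz dv energy]] := sol_geodesic_equations gamma a b geo unit ab.
have a0 : a != 0.
  apply/eqP => a0; apply: (gen ix); exists (xc (gamma 0)) => t.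
  by apply: (eq0_derive_cst (xc \o gamma)) => s; have := dx s; rewrite a0 mul0r.
have b0 : b != 0.
  apply/eqP => b0; apply: (gen iy); exists (yc (gamma 0)) => t.
  by apply: (eq0_derive_cst (yc \o gamma)) => s; have := dy s; rewrite b0 mul0r.
set c := `|a * b|.
have c0 : 0 < c by rewrite normr_gt0 mulf_neq0.
pose X t := `|a| * expR (zc (gamma t)).
pose Y t := `|b| * expR (- zc (gamma t)).
have XY t : X t * Y t = c.
  by rewrite /X /Y /c mulrACA expRMN mulr1 normrM.
have XX t : X t ^+ 2 = a ^+ 2 * expR (2 * zc (gamma t)).
  by rewrite exprMn real_normK ?num_real// [expR _ ^+ 2]expr2 -expRD -mulr2n mulr_natl.
have YY t : Y t ^+ 2 = b ^+ 2 * expR (- 2 * zc (gamma t)).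
  rewrite exprMn real_normK ?num_real// [expR _ ^+ 2]expr2 -expRD.
  by rewrite mulNr -mulr2n mulr_natl mulNrn.
have X0 t : 0 < X t by rewrite mulr_gt0 ?normr_gt0 ?expR_gt0.
have Y0 t : 0 < Y t by rewrite mulr_gt0 ?normr_gt0 ?expR_gt0.
have E t : (X t - Y t) ^+ 2 + v t ^+ 2 = 1 - 2 * c.
  have := energy t; rewrite -XX -YY -(XY t) => en.
  by rewrite -[X in _ = X - _]en; ring.
have c1 : 2 * c < 1.
  (* At 2c = 1 the energy identity makes z' vanish identically. *)
  rewrite lt_neqAle; apply/andP; split; last first.
    by have := E 0; have := sqr_ge0 (X 0 - Y 0); have := sqr_ge0 (v 0); lra.
  apply/eqP => c1; apply: (gen iz); exists (zc (gamma 0)) => t.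
  apply: (eq0_derive_cst (zc \o gamma)) => s; have := dz s.
  suff -> : v s = 0 by [].
  have := E s; rewrite c1 subrr => /eqP.
  by rewrite paddr_eq0 ?sqr_ge0// !expf_eq0/= => /andP[_ /eqP].
have dX (t : R) : is_derive t 1 X (X t * v t).
  have dexp := @is_derive1_comp R expR (zc \o gamma) t _ _ (is_derive_expR _) (dz t).
  have dd := is_deriveZ `|a| dexp.
  by apply: is_derive_eq dd _; rewrite /GRing.scale/= /X; ring.
have dY (t : R) : is_derive t 1 Y (- (Y t * v t)).
  have dexp := @is_derive1_comp R expR (- (zc \o gamma)) t _ _
    (is_derive_expR _) (is_deriveN (dz t)).
  have dd := is_deriveZ `|b| dexp.
  by apply: is_derive_eq dd _; rewrite /GRing.scale/= /Y; ring.
have dv' (t : R) : is_derive t 1 v (Y t ^+ 2 - X t ^+ 2) by rewrite XX YY.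
have [th [dth sumE diffE]] := phase_lift c X Y v c0 c1 dX dY dv' XY
  (fun t => addr_gt0 (X0 t) (Y0 t)) E.
have [absE A0 cA] := modulus_spec a b c0 c1.
rewrite -/k -/c in absE A0 cA.
have xinc t s : th s = th t + pi *+ 2 ->
    a * (xc (gamma s) - xc (gamma t)) = c * integral_M k.
  move=> ths; rewrite mulrBr /integral_M absE.
  apply: (phase_square_increment c _ 1 th (fun t => a * xc (gamma t))
    c0 c1 A0 cA (expr1n _ _) dth) => // y.
  rewrite mul1r -sumE -diffE.
  have -> : (X y + Y y + (X y - Y y)) / 2 = X y by field.
  rewrite XX expr2 -mulrA; exact: (is_deriveZ a (dx y)).
have yinc t s : th s = th t + pi *+ 2 ->
    b * (yc (gamma s) - yc (gamma t)) = c * integral_M k.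
  move=> ths; rewrite mulrBr /integral_M absE.
  have N1 : (- 1) ^+ 2 = 1 :> R by rewrite sqrrN expr1n.
  apply: (phase_square_increment c _ (- 1) th (fun t => b * yc (gamma t))
    c0 c1 A0 cA N1 dth) => // y.
  rewrite mulN1r -sumE -diffE.
  have -> : (X y + Y y - (X y - Y y)) / 2 = Y y by field.
  rewrite YY expr2 -mulrA; exact: (is_deriveZ b (dy y)).
split; last by rewrite absE.
move=> t0; rewrite /displacement absE.
have ths : th (t0 + period_T k) = th t0 + pi *+ 2.
  by rewrite /period_T absE; exact: (phase_period c (artanh k) th c0 c1 A0 cA dth).
have Mge0 : 0 <= integral_M k.
  rewrite /integral_M mulr_ge0//; apply: Rintegral_ge0 => u _.
  by rewrite divr_ge0 ?sqrtr_ge0// ltW// cosh_gt0.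
rewrite -normrM.
have -> : (xc (gamma (t0 + period_T k)) - xc (gamma t0)) *
    (yc (gamma (t0 + period_T k)) - yc (gamma t0)) = (c * integral_M k) ^+ 2 / (a * b).
  by rewrite expr2 -{1}(xinc _ _ ths) -(yinc _ _ ths); field; rewrite a0 b0.
rewrite normrM normfV -/c normrX.
have -> : `|c * integral_M k| ^+ 2 / c = c * integral_M k ^+ 2.
  by rewrite real_normK ?num_real//; field; rewrite gt_eqF.
by rewrite sqrtrM ?ltW// sqrtr_sqr ger0_norm.
Qed.
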